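(* Let $X$ be a completely regular Hausdorff space. Then the following are equivalent: (a) for every realcompact space $Y$ with $X\subseteq Y\subseteq\beta X$ there exists an ideal $\mathcal{P}$ of closed sets in $X$ such that $Y=\upsilon_{C_{\mathcal{P}}}X$; (b) $X$ is pseudocompact.
   Context: $C(X)$ is the ring of all real-valued continuous functions on $X$; $\beta X$ is the Stone-Čech compactification of $X$. Spaces between $X$ and $\beta X$ are taken as subspaces of $\beta X$. For $f\in C(X)$, $Z(f)=\{x\in X: f(x)=0\}$ and $f^*:\beta X\to\mathbb{R}\cup\{\infty\}$ is the unique continuous extension of $f$ to $\beta X$ with values in the one-point compactification of $\mathbb{R}$. An ideal of closed sets in $X$ is a family $\mathcal{P}$ of closed subsets of $X$ such that (1) $A,B\in\mathcal{P}$ implies $A\cup B\in\mathcal{P}$, and (2) $A\in\mathcal{P}$, $B\subseteq A$ with $B$ closed in $X$ implies $B\in\mathcal{P}$. For such $\mathcal{P}$, $C_{\mathcal{P}}(X)=\{f\in C(X): \mathrm{cl}_X(X\setminus Z(f))\in\mathcal{P}\}$ and $\upsilon_{C_{\mathcal{P}}}X=\{p\in\beta X: f^*(p)\in\mathbb{R}\text{ for all } f\in C_{\mathcal{P}}(X)\}$. A space $X$ is pseudocompact if every $f\in C(X)$ is bounded. *)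

(* Defs.v *)
From HB Require Import structures.
From mathcomp Require Import all_boot all_order all_algebra.
From mathcomp Require Import all_classical all_reals all_analysis.

Set Implicit Arguments.
Unset Strict Implicit.
Unset Printing Implicit Defensive.

Import Order.TTheory GRing.Theory Num.Theory.
Import numFieldNormedType.Exports.

Local Open Scope classical_set_scope.
Local Open Scope ring_scope.

Definition is_embedding (S T : topologicalType) (i : S -> T) : Prop :=
  injective i /\ forall A : set S, open A <-> exists2 U, open U & i @^-1` U = A.

(* [i : X -> K] exhibits K as beta X.  The extension in the last field is
   unique, since the range of i is dense and T is Hausdorff. *)
Record is_stone_cech (X K : topologicalType) (i : X -> K) : Prop := IsStoneCech {
  stone_cech_compact : compact [set: K] ;
  stone_cech_hausdorff : hausdorff_space K ;
  stone_cech_embedding : is_embedding i ;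
  stone_cech_dense : dense (range i) ;
  stone_cech_universal : forall (T : topologicalType) (g : X -> T),
    compact [set: T] -> hausdorff_space T -> continuous g ->
    exists2 G : K -> T, continuous G & forall x, G (i x) = g x
}.

Section ContinuousFunctionRing.
Context {R : realType}.

Definition Cont (T : topologicalType) : set (T -> R) :=
  [set f | continuous f].
Arguments Cont T : clear implicits.

Definition zero_set (T : topologicalType) (f : T -> R) : set T :=
  [set x | f x = 0].

Section Ideals.
Variable T : topologicalType.
Implicit Types (I : set (T -> R)).

Definition is_ideal I : Prop :=
  [/\ I `<=` Cont T,
      I (cst 0),
      (forall f g, I f -> I g -> I (f \+ g)) &
      (forall h f, Cont T h -> I f -> I (h \* f))].

Definition is_proper_ideal I : Prop := is_ideal I /\ ~ I (cst 1).

Definition is_maximal_ideal I : Prop :=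
  is_proper_ideal I /\ forall J, is_proper_ideal J -> I `<=` J -> J = I.

(* The image of the constant functions is the whole residue field C(T)/I. *)
Definition is_real_ideal I : Prop :=
  forall f, Cont T f -> exists r : R, I (f \- cst r).

Definition is_fixed_ideal I : Prop := exists x, forall f, I f -> f x = 0.

End Ideals.

(* Hewitt's definition, as in Gillman and Jerison. *)
Definition realcompact (T : topologicalType) : Prop :=
  [/\ completely_regular_space T, hausdorff_space T &
      forall M : set (T -> R),
        is_maximal_ideal M -> is_real_ideal M -> is_fixed_ideal M].

Definition pseudocompact (T : topologicalType) : Prop :=
  forall f, Cont T f -> bounded_fun f.

Definition ideal_of_closed_sets (X : topologicalType) (P : set (set X)) : Prop :=
  [/\ (forall A, P A -> closed A),
      (forall A B, P A -> P B -> P (A `|` B)) &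
      (forall A B, P A -> B `<=` A -> closed B -> P B)].

Definition C_ (X : topologicalType) (P : set (set X)) : set (X -> R) :=
  [set f | Cont X f /\ P (closure (~` zero_set f))].

Section StoneExtension.
Context {X K : topologicalType}.
Variable i : X -> K.

(* f^*, with [None] the point at infinity; for [is_stone_cech i] and continuous
   f, it is characterized by [stone_extP] and [stone_ext_unique] below. *)
Definition stone_ext (f : X -> R) : K -> one_point_compactification R :=
  xget (fun=> None)
    [set F : K -> one_point_compactification R | continuous F /\ forall x, F (i x) = Some (f x)].

Definition upsilon (P : set (set X)) : set K :=
  [set p | forall f, C_ P f -> exists r : R, stone_ext f p = Some r].

End StoneExtension.

Lemma hausdorff_opcR : hausdorff_space (one_point_compactification R).
Proof.
apply: one_point_compactification_hausdorff; last exact: Rhausdorff.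
exact: locally_compactR.
Qed.

Lemma dense_ext_unique (X K T : topologicalType) (i : X -> K) (F G : K -> T) :
  dense (range i) -> hausdorff_space T -> continuous F -> continuous G ->
  (forall x, F (i x) = G (i x)) -> F = G.
Proof.
move=> di hT cF cG FG; apply/funext => k; apply: hT => A B nA nB.
have : nbhs k (F @^-1` A `&` G @^-1` B) by apply: filterI; [exact: cF|exact: cG].
rewrite nbhsE => -[V [oV Vk] VAB].
have [|y [Vy [x _ xy]]] := di V _ oV; first by exists k.
exists (F (i x)); rewrite -xy in Vy; have [? Bx] := VAB _ Vy.
by split=> //; rewrite FG.
Qed.

Lemma stone_extP (X K : topologicalType) (i : X -> K) (f : X -> R) :
  is_stone_cech i -> Cont X f ->
  continuous (stone_ext i f) /\ forall x, stone_ext i f (i x) = Some (f x).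
Proof.
move=> sc cf; rewrite /stone_ext; case: xgetP => [F _ []// | nF]; exfalso.
have cSf : continuous ((Some : R -> one_point_compactification R) \o f).
  move=> x; apply: continuous_comp; first exact: cf.
  exact: one_point_compactification_some_continuous.
have [F cF Ff] := stone_cech_universal sc
  (@one_point_compactification_compact R) hausdorff_opcR cSf.
exact: (nF F).
Qed.

Lemma stone_ext_unique (X K : topologicalType) (i : X -> K) (f : X -> R)
    (F : K -> one_point_compactification R) :
  is_stone_cech i -> Cont X f ->
  continuous F -> (forall x, F (i x) = Some (f x)) -> F = stone_ext i f.
Proof.
move=> sc cf cF Ff; have [cE Ef] := stone_extP sc cf.
apply: (dense_ext_unique (stone_cech_dense sc) hausdorff_opcR cF cE) => x.
by rewrite Ff Ef.
Qed.

End ContinuousFunctionRing.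

Arguments Cont {R} T.

Lemma hausdorff_set_type (T : topologicalType) (A : set T) :
  hausdorff_space T -> hausdorff_space A.
Proof.
move=> hT p q pq; apply: val_inj; apply: hT => U V nU nV.
have cv := @initial_continuous A T set_val.
have [z [zU zV]] := pq _ _ (cv p _ nU) (cv q _ nV).
by exists (\val z).
Qed.

Lemma compact_set_type (T : topologicalType) (A : set T) :
  compact A -> compact [set: A].
Proof.
move=> cA F PF _; pose G := (set_val : A -> T) @ F.
have GA : G A.
  change (F (set_val @^-1` A)); apply: filterS (@filterT _ F _) => a _.
  exact: set_valP.
have [p [Ap clp]] := cA G _ GA.
exists (exist _ p (mem_set Ap)); split=> // U V FU.
case=> _ [[W oW <-] Wp WV].
have GU : G (set_val @` U) 
  by rewrite /G /=; apply: filterS FU => a Ua; exists a.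
have [_ [[a Ua <-] Wa]] := clp _ W GU (open_nbhs_nbhs (conj oW Wp)).
by exists a; split=> //; exact: WV.
Qed.

Lemma completely_regular_subspace (R : realType) (T : topologicalType)
    (A : set T) :
  completely_regular_space T -> completely_regular_space A.
Proof.
move=> crT a B clB Ba.
have : open (~` B) by rewrite openC.
case=> W oW WB.
have nW : ~ (~` W) (set_val a) by apply; rewrite -[W _]/((set_val @^-1` W) a) WB.
have /(uniform_separatorP (R := R)) [f [cf f01 fa fW]] :=
  crT _ _ (open_closedC oW) nW.
apply/(uniform_separatorP (R := R)); exists (f \o set_val); split.
- move=> x; apply: continuous_comp; last exact: cf.
  exact: initial_continuous.
- by move=> _ [x _ <-]; apply: f01; exists (set_val x).
- by move=> _ [x -> <-]; apply: fa; exists (set_val a).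
- move=> _ [x Bx <-]; apply: fW; exists (set_val x) => // Wx.
  by have : (~` B) x by rewrite -WB.
Qed.

Section StoneCechExistence.
Variable R : realType.

Definition unit_fun (T : topologicalType) : set (T -> R) :=
  [set f : T -> R | continuous f /\ range f `<=` `[0, 1]].
Arguments unit_fun T : clear implicits.

Definition cube (T : topologicalType) : topologicalType :=
  prod_topology (fun _ : unit_fun T => R : topologicalType).

Definition to_cube (T : topologicalType) : T -> cube T :=
  join_product (fun f : unit_fun T => set_val f : T -> R).

Lemma unit_fun_cont (T : topologicalType) (f : unit_fun T) :
  continuous (set_val f : T -> R).
Proof. by have [] := set_valP f. Qed.

Lemma unit_fun_sep (T : topologicalType) : completely_regular_space T ->
  separate_points_from_closed (fun f : unit_fun T => set_val f : T -> R).
Proof.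
move=> crT U x clU Ux.
have /(uniform_separatorP (R := R)) [f [cf f01 fx fU]] := crT _ _ clU Ux.
have uf : unit_fun T f by [].
exists (exist _ f (mem_set uf)) => /=; rewrite set_valE /=.
have -> : f x = 0 by apply: fx; exists x.
move=> /(closureS fU); rewrite -(closure_id [set 1 : R]).1 //=.
  by move=> /eqP; rewrite eq_sym oner_eq0.
Qed.

Lemma to_cube_embedding (T : topologicalType) :
  completely_regular_space T -> hausdorff_space T -> is_embedding (@to_cube T).
Proof.
move=> crT hT; have sT := unit_fun_sep crT.
have inj := join_product_inj sT (hausdorff_accessible hT).
split; first by move=> x y; apply: inj; rewrite inE.
by move=> A; rewrite (join_product_initial sT (@unit_fun_cont T) inj).
Qed.

Lemma cube_cont (S T : topologicalType) (F : S -> cube T) :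
  (forall f : unit_fun T, continuous (fun s => F s f)) -> continuous F.
Proof.
move=> cF s; apply/cvg_sup => f.
move: s; apply/(@continuousP _ (initial_topology (@^~ f))) => _ [B oB <-].
rewrite -[_ @^-1` _]/((fun s => F s f) @^-1` B).
by apply: open_comp => // s _; exact: cF.
Qed.

Lemma cube_hausdorff (T : topologicalType) : hausdorff_space (cube T).
Proof.
by apply: (@hausdorff_product _ (fun=> R)) => _; exact: Rhausdorff.
Qed.

Definition beta (T : topologicalType) : set (cube T) :=
  closure (range (@to_cube T)).
Arguments beta T : clear implicits.

Definition to_beta (T : topologicalType) (x : T) : beta T :=
  exist _ (to_cube x) (mem_set (subset_closure (imageP (@to_cube T) I))).

Lemma beta_compact (T : topologicalType) : compact (beta T).
Proof.
apply: (@subclosed_compact _ _ [set g : cube T | forall f, `[0, 1]%classic (g f)]).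
- exact: closed_closure.
- apply: (@tychonoff (unit_fun T) (fun=> R : topologicalType)
    (fun=> `[0, 1]%classic)) => _.
  exact: segment_compact.
- rewrite /beta [X in _ `<=` X](closure_id _).1.
    apply: closureS => _ [x _ <-] f.
    by have [_] := set_valP f; apply; exists x.
  apply: compact_closed; first exact: cube_hausdorff.
  apply: (@tychonoff (unit_fun T) (fun=> R : topologicalType)
    (fun=> `[0, 1]%classic)) => _.
  exact: segment_compact.
Qed.

(* Beta X exists, so quantifying over [is_stone_cech] is not vacuous. *)
Theorem stone_cech_exists (X : topologicalType) :
  completely_regular_space X -> hausdorff_space X ->
  is_stone_cech (@to_beta X).
Proof.
move=> crX hX; have [injX opX] := to_cube_embedding crX hX.
split.
- exact/compact_set_type/beta_compact.
- exact/hausdorff_set_type/cube_hausdorff.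
- split=> [x y xy|A]; first by apply: injX; exact: (congr1 set_val xy).
  split=> [/opX[U oU UA]|[_ [W oW <-] <-]].
    by exists (set_val @^-1` U); [exists U|].
  by apply/opX; exists W.
- move=> V [k Vk] [W oW WV]; subst V.
  have /= := set_valP k => /(_ W (open_nbhs_nbhs (conj oW Vk))).
  by move=> [_ [[x _ <-] Wx]]; exists (to_beta x); split=> //; exists x.
move=> T g cT hT cg.
have crT : completely_regular_space T.
  apply: (@normal_completely_regular R); last exact: hausdorff_accessible.
  exact: compact_normal.
have [injT opT] := to_cube_embedding crT hT.
have uP (f : unit_fun T) : unit_fun X ((set_val f : T -> R) \o g).
  have [cf f01] := set_valP f; split; last first.
    by move=> _ [x _ <-]; apply: f01; exists (g x).
  by move=> x; apply: continuous_comp; [exact: cg|exact: cf].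
pose u (f : unit_fun T) : unit_fun X :=
  exist _ ((set_val f : T -> R) \o g) (mem_set (uP f)).
pose Phi (k : cube X) : cube T := fun f => k (u f).
have cPhi : continuous Phi.
  by apply: cube_cont => f; exact: (@proj_continuous _ (fun=> R) (u f)).
have cE : continuous (@to_cube T).
  by apply: cube_cont => f; exact: unit_fun_cont.
have clE : closed (range (@to_cube T)).
  apply: compact_closed; first exact: cube_hausdorff.
  by apply: continuous_compact => //; exact: continuous_subspaceT.
have PhiE x : Phi (to_cube x) = to_cube (g x) by [].
have rPhi (k : beta X) : range (@to_cube T) (Phi (set_val k)).
  have : closed (Phi @^-1` range (@to_cube T)).
    by apply: closed_comp => // *; exact: cPhi.
  move=> /closure_id E.
  suff : (Phi @^-1` range (@to_cube T)) (set_val k) by [].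
  rewrite E; have := set_valP k; apply: closureS => _ [x _ <-].
  by rewrite /= PhiE; exists (g x).
have /choice [G GE] : forall k : beta X,
    exists t, to_cube t = Phi (set_val k).
  by move=> k; have [t _ tE] := rPhi k; exists t.
exists G; last by move=> x; apply: injT; rewrite GE.
apply/continuousP => A /opT [W oW <-].
rewrite -comp_preimage (_ : _ \o G = Phi \o set_val).
  exists (Phi @^-1` W) => //.
  by apply: open_comp => // *; exact: cPhi.
by apply/funext => k /=; rewrite GE.
Qed.

End StoneCechExistence.

(* Main.v *)
(* If X is pseudocompact, every p in beta X gives a real maximal ideal of C(Y),
   which realcompactness of Y forces to be fixed at p; so Y = beta X.

   Conversely, for every ideal P of closed sets, upsilon P minus the Hewitt
   realcompactification of X is relatively closed in beta X minus it.  If f is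
   unbounded on X, pick points x_n along which f grows fast and h, continuous,
   with h(x_n) = logn 2 n.  For each k, the x_n with logn 2 n = k accumulate at
   some q_k where f* is infinite and h* = k.  The set of points where h* is
   finite is realcompact, contains every q_k and misses every cluster point of
   the q_k, hence is not of the form upsilon P. *)
Require Import Defs.
From HB Require Import structures.
From mathcomp Require Import all_boot all_order all_algebra.
From mathcomp Require Import all_classical all_reals all_analysis.
From mathcomp Require Import lra.

Set Implicit Arguments.
Unset Strict Implicit.
Unset Printing Implicit Defensive.

Import Order.TTheory GRing.Theory Num.Theory.
Import numFieldNormedType.Exports.

Local Open Scope classical_set_scope.

(** * Cluster points of sequences and neighbourhoods of infinity *)

Section Clusters.
Local Open Scope ring_scope.

Lemma cluster_seq_closed (T : topologicalType) (u : nat -> T) (C : set T) q :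
  closed C -> (forall n, C (u n)) -> cluster (u @ \oo) q -> C q.
Proof.
move=> clC Cu clq; apply: clC => A nA; apply: clq => //.
by apply: filterS (@filterT _ (\oo : set_system nat) _) => n _; exact: Cu.
Qed.

(** This is the complement of the compact interval [[- c, c]]; the point at infinity satisfies the
    condition vacuously. *)
Lemma nbhs_opc_infty (R : realType) (c : R) :
  nbhs (None : one_point_compactification R)
    [set z | forall r, z = Some r -> c < `|r|].
Proof.
exists `[- c, c]%classic.
  by split; [exact: segment_compact|exact: interval_closed].
move=> _ [[r /= rc <-] s [<-]|-> //].
rewrite ltNge; apply/negP; rewrite ler_norml => ?; apply: rc.
by rewrite /= in_itv.
Qed.

(** A finite value [r] at [q] would bring [v n] within 1 of [r] for arbitrarily large [n], against
    [n <= v n]. *)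
Lemma cluster_seq_infty (R : realType) (T : topologicalType)
    (F : T -> one_point_compactification R) (u : nat -> T) (v : nat -> R) q :
  continuous F -> (forall n, F (u n) = Some (v n)) ->
  (forall n, n%:R <= v n) -> cluster (u @ \oo) q -> F q = None.
Proof.
move=> cF Fu vn clq; case E: (F q) => [r|//]; exfalso.
have nq : nbhs q (F @^-1` (Some @` ball r 1)).
  apply: cF; rewrite E; apply: one_point_compactification_some_nbhs.
  exact: nbhsx_ballx.
have [N rN] : exists N : nat, r + 1 < N%:R.
  by exists (Num.truncn (r + 1)).+1; exact: truncnS_gt.
have nu : (u @ \oo) (u @` [set n | (N <= n)%N]) by exists N => // n ?; exists n.
have [_ [[n /= Nn <-] [s rs]]] := clq _ _ nu nq; rewrite Fu => -[sv]; subst s.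
move: rs; rewrite /ball /= distrC => /(le_lt_trans (ler_norm _)).
have := vn n; have : N%:R <= n%:R :> R by rewrite ler_nat.
lra.
Qed.

End Clusters.

(** * Real maximal ideals of rings of continuous functions *)

Section Ideals.
Local Open Scope ring_scope.
Context {R : realType} {T : topologicalType}.
Implicit Types I : set (T -> R).

(** The common zeros of [f] and [g] are the zeros of [f^2 + g^2], and a function without zeros is a
    unit. *)
Lemma ideal_zero_set_proper I :
  is_proper_ideal I -> ProperFilter (filter_from I (@zero_set R T)).
Proof.
move=> [[IC I0 ID IM] I1]; apply: filter_from_proper.
  apply: filter_from_filter; first by exists (cst 0).
  move=> f g If Ig; exists ((f \* f) \+ (g \* g)).
    by apply: ID; apply: IM => //; exact: IC.
  move=> x /= /eqP.
  by rewrite paddr_eq0 ?sqr_ge0 // !mulf_eq0 !orbb => /andP[/eqP ? /eqP].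
move=> f If; apply: contrapT => nf; apply: I1.
have f0 x : f x != 0 by apply/eqP => fx; apply: nf; exists x.
rewrite (_ : cst 1 = (fun x => (f x)^-1) \* f).
  by apply: IM => // x; apply: cvgV => //; exact: (IC _ If).
by apply/funext => x /=; rewrite mulVf.
Qed.

(** For [f] in a proper [J] containing [I], the constant [r] with [f - r] in [I] lies in [J]. It is
    then not a unit, so [r = 0] and [f] is in [I]. *)
Lemma real_ideal_maximal I :
  is_proper_ideal I -> is_real_ideal I -> is_maximal_ideal I.
Proof.
move=> pI rI; split=> // J [[JC J0 JD JM] J1] IJ; apply/seteqP; split=> // f Jf.
have [r Ir] := rI _ (JC _ Jf).
have cc (a : R) : Cont T (cst a) by move=> ?; exact: cvg_cst.
have Jr : J (cst r).
  rewrite (_ : cst r = f \+ (cst (-1) \* (f \- cst r))).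
    by apply: JD => //; apply: JM => //; exact: IJ.
  by apply/funext => x /=; rewrite /cst; lra.
have [r0|r0] := eqVneq r 0.
  by rewrite (_ : f = f \- cst r) //; apply/funext => x /=; rewrite r0 subr0.
exfalso; apply: J1; rewrite (_ : cst 1 = cst r^-1 \* cst r); first exact: JM.
by apply/funext => x /=; rewrite /cst mulVf.
Qed.

(** [I] is the kernel of the ring homomorphism to the reals that takes limits along [F]. *)
Lemma limit_ideal (F : set_system T) (FF : ProperFilter F) :
  (forall f : T -> R, Cont T f -> exists r : R, f @ F --> r) ->
  let I := [set f : T -> R | Cont T f /\ f @ F --> (0 : R)] in
  is_maximal_ideal I /\ is_real_ideal I.
Proof.
move=> lim I; have rI : is_real_ideal I.
  move=> f cf; have [r fr] := lim f cf; exists r; split.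
    by move=> x; apply: cvgB; [exact: cf|exact: cvg_cst].
  by rewrite -(subrr r); apply: cvgB => //; exact: cvg_cst.
split=> //; apply: real_ideal_maximal => //; split; last first.
  move=> [_ c1].
  suff : (0 : R) = 1 by move/eqP; rewrite eq_sym oner_eq0.
  by apply: cvg_unique c1 _; [exact: Rhausdorff|exact: cvg_cst].
split.
- by move=> f [].
- by split=> [x|]; exact: cvg_cst.
- move=> f g [cf f0] [cg g0]; split; last by rewrite -(addr0 0); exact: cvgD.
  by move=> x; apply: cvgD; [exact: cf|exact: cg].
- move=> f g cf [cg g0]; split.
    by move=> x; apply: cvgM; [exact: cf|exact: cg].
  by have [r fr] := lim f cf; rewrite -(mulr0 r); exact: cvgM.
Qed.

End Ideals.

(** * Extensions to beta X and realcompact spaces between X and beta X *)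

Section StoneExt.
Local Open Scope ring_scope.
Context {R : realType} {X K : topologicalType} {i : X -> K}.
Hypothesis sci : is_stone_cech i.

(** Limits along this filter on X recover the finite values of f^* at [p]; density of X makes it
    proper. *)
Definition trace (p : K) : set_system X := filter_from (nbhs p) (preimage i).

#[local] Instance trace_proper p : ProperFilter (trace p).
Proof.
apply: filter_from_proper.
  apply: filter_from_filter; first by exists setT; exact: filterT.
  by move=> A B nA nB; exists (A `&` B) => //; exact: filterI.
move=> A; rewrite nbhsE => -[V [oV Vp] VA].
have [|y [Vy [x _ xE]]] := stone_cech_dense sci _ oV; first by exists p.
by exists x; apply: VA; rewrite xE.
Qed.

Lemma cont_embedding : continuous i.
Proof.
have [_ oi] := stone_cech_embedding sci.
by apply/continuousP => U oU; apply/oi; exists U.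
Qed.

Lemma continuous_trace (f : K -> R) p :
  continuous f -> (f \o i) @ trace p --> f p.
Proof. by move=> cf A /cf nA; exists (f @^-1` A). Qed.

Lemma stone_ext_cvg (f : X -> R) p r :
  Cont X f -> stone_ext i f p = Some r -> f @ trace p --> r.
Proof.
move=> cf fp; have [cF Ff] := stone_extP sci cf => A nA.
exists (stone_ext i f @^-1` (Some @` A)).
  by apply: cF; rewrite fp; exact: one_point_compactification_some_nbhs.
by move=> x /=; rewrite Ff => -[a Aa [<-]].
Qed.

Lemma stone_ext_infty (f : X -> R) p c :
  Cont X f -> stone_ext i f p = None -> \forall x \near trace p, c < `|f x|.
Proof.
move=> cf fp; have [cF Ff] := stone_extP sci cf.
exists (stone_ext i f @^-1` [set z | forall r, z = Some r -> c < `|r|]).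
  by apply: cF; rewrite fp; exact: nbhs_opc_infty.
by move=> x /=; rewrite Ff => /(_ _ erefl).
Qed.

Lemma bounded_stone_ext (f : X -> R) p c :
  Cont X f -> (forall x, `|f x| <= c) -> exists r, stone_ext i f p = Some r.
Proof.
move=> cf fc; case fp: (stone_ext i f p) => [r|]; first by exists r.
have [x] := filter_ex (stone_ext_infty c cf fp).
by rewrite ltNge fc.
Qed.

Lemma completely_regular_beta : completely_regular_space K.
Proof.
have hK := stone_cech_hausdorff sci; have cK := stone_cech_compact sci.
apply: (@normal_completely_regular R); last exact: hausdorff_accessible.
exact: compact_normal.
Qed.

(* For a real maximal ideal M there is r with h - r in M; the zero set of
   h - r is compact, and it meets the zero sets of M in a filter base. *)
Lemma realcompact_finite_locus (h : X -> R) : Cont X h ->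
  realcompact (R := R) [set q | exists r, stone_ext i h q = Some r].
Proof.
move=> ch; have [cH Hh] := stone_extP sci ch.
set Y := [set q | _]; split.
- exact/(completely_regular_subspace R)/completely_regular_beta.
- exact/hausdorff_set_type/(stone_cech_hausdorff sci).
move=> M [pM _] rM; have [[MC _ _ _] _] := pM.
(* The default 0 is never taken, as h^* is finite on [Y]. *)
pose hY (y : Y) : R := odflt 0 (stone_ext i h (set_val y)).
have hYE (y : Y) : stone_ext i h (set_val y) = Some (hY y).
  by rewrite /hY; have [r ->] := set_valP y.
have chY : continuous hY.
  move=> y A nA.
  have nA' : nbhs (set_val y) (stone_ext i h @^-1` (Some @` A)).
    by apply: cH; rewrite hYE; exact: one_point_compactification_some_nbhs.
  have nY : nbhs y (set_val @^-1` (stone_ext i h @^-1` (Some @` A))).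
    exact: (@initial_continuous Y K set_val y).
  by apply: filterS nY => z /=; rewrite hYE => -[a Aa [<-]].
have [r Mr] := rM _ chY.
pose G := filter_from M (@zero_set R Y).
have PG : ProperFilter G by exact: ideal_zero_set_proper.
have cK : compact [set: K] := stone_cech_compact sci.
(* The cluster point is found in the compact space [K]; the value [r] of h^* there puts it back in
   [Y]. *)
have [q [_ clq]] := cK (set_val @ G) _ filterT.
have hq : stone_ext i h q = Some r.
  have clr : closed [set Some r : one_point_compactification R].
    exact: (accessible_closed_set1 (hausdorff_accessible hausdorff_opcR)).
  suff : closure (stone_ext i h @^-1` [set Some r]) q.
    rewrite -(closure_id _).1 //; apply: preimage_closed => // ? _; exact: cH.
  move=> A nA; apply: clq => //; exists (hY \- cst r) => // y /= /eqP.
  by rewrite subr_eq0 hYE => /eqP ->.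
have Yq : Y q by exists r.
exists (exist _ q (mem_set Yq)) => f Mf.
have cf := MC _ Mf.
suff : closure [set y | f y = 0] (exist _ q (mem_set Yq)).
  rewrite -(closure_id _).1 //.
  apply: (@preimage_closed _ _ f [set 0]) => // ? _; exact: cf.
move=> A [_ [[W oW <-] Wq WA]].
have GZ : (set_val @ G) (set_val @` [set y : Y | f y = 0]).
  by exists f => // y fy; exists y.
have [_ [[y fy <-] Wy]] := clq _ W GZ (open_nbhs_nbhs (conj oW Wq)).
by exists y; split=> //; exact: WA.
Qed.

(** Continuous functions on [Y] are bounded on X, so they have limits at every [p] of [K]. Those
    with limit 0 form a real maximal ideal, fixed at some [y] of [Y]; a function on [K] separating
    [p] from [y] would contradict this, so [p = y]. *)
Lemma pseudocompact_realcompact_full (Y : set K) :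
  pseudocompact (R := R) X -> range i `<=` Y -> realcompact (R := R) Y ->
  Y = setT.
Proof.
move=> psX iY [_ _ rcY]; apply/seteqP; split=> // p _.
pose j (x : X) : Y := exist _ (i x) (mem_set (iY _ (imageP i I))).
have cj : continuous j.
  apply/continuousP => _ [W oW <-].
  by move/continuousP : cont_embedding; exact.
have lim (f : Y -> R) : Cont Y f -> exists r : R, f @ (j @ trace p) --> r.
  move=> cf.
  have cfj : Cont X (f \o j).
    by move=> x; exact: (continuous_comp (cj x) (cf (j x))).
  have [c [_ /(_ (c + 1))]] := psX _ cfj; rewrite ltrDl ltr01 => /(_ isT) fc.
  have [r fr] := bounded_stone_ext p cfj (fun x => fc x I).
  by exists r; exact: stone_ext_cvg.
have [maxM rM] := limit_ideal _ lim.
have [y My] := rcY _ maxM rM.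
suff -> : p = set_val y by exact: set_valP.
apply: contrapT => py.
have cl1 : closed [set set_val y].
  exact: (accessible_closed_set1
    (hausdorff_accessible (stone_cech_hausdorff sci))).
have /(uniform_separatorP (R := R)) [u [cu _ up uy]] :=
  completely_regular_beta cl1 py.
have u0 : u p = 0 by apply: up; exists p.
have Mu : Cont Y (u \o set_val) /\ (u \o set_val) @ (j @ trace p) --> (0 : R).
  split; last by rewrite -u0; exact: continuous_trace.
  by move=> z; apply: continuous_comp;
    [exact: initial_continuous|exact: cu].
have := My _ Mu; rewrite /= (uy (u (set_val y))); last by exists (set_val y).
by move=> /eqP; rewrite oner_eq0.
Qed.

(* Near p one has |g| > 1, so f g, which lies in C_P, is infinite wherever
   f is. *)
Lemma upsilon_rel_closed (P : set (set X)) (f : X -> R) p (A : set K) :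
  ideal_of_closed_sets P -> Cont X f ->
  (forall q, A q -> stone_ext i f q = None) ->
  A `<=` upsilon (R := R) i P -> closure A p -> upsilon (R := R) i P p.
Proof.
move=> [_ _ Psub] cf Af AP clA g [cg Pg].
case gp: (stone_ext i g p) => [r|]; first by exists r.
exfalso; have [cG Gg] := stone_extP sci cg.
pose W := stone_ext i g @^-1` [set z | forall r, z = Some r -> 1 < `|r|].
have nW : nbhs p W by apply: cG; rewrite gp; exact: nbhs_opc_infty.
(* Using the interior makes [W] a neighbourhood of [q] as well. *)
have [q [Aq Wq]] := clA _ (nbhs_interior nW).
have cfg : Cont X (f \* g).
  by move=> x; apply: cvgM; [exact: cf|exact: cg].
have Pfg : C_ P (f \* g).
  (* The product vanishes wherever [g] does, so its support is contained in that of [g]. *)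
  split=> //; apply: Psub Pg _ (@closed_closure _ _); apply: closureS.
  by move=> x /= fg gx; apply: fg; rewrite /zero_set /= gx mulr0.
have [r fgr] := AP q Aq _ Pfg.
have nr : \forall x \near trace q, `|(f \* g) x| < `|r| + 1.
  have fgq := @cvg_norm _ _ _ _ (trace_proper q) _ _ (stone_ext_cvg cfg fgr).
  by apply: (cvgr_lt `|r| fgq); rewrite ltrDl.
have ng : \forall x \near trace q, 1 < `|g x|.
  by exists W => // x /=; rewrite /W /= Gg => /(_ _ erefl).
(* Near [q], both [|f| > |r| + 1] and [|g| > 1] hold, yet [|f g| < |r| + 1]. *)
have nf := stone_ext_infty (`|r| + 1) cf (Af q Aq).
have [x [[fx gx] fgx]] := filter_ex (filterI (filterI nf ng) nr).
move: fgx; rewrite /= normrM ltNge => /negP; apply.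
apply: (le_trans (ltW fx)).
by rewrite ler_peMr // ltW.
Qed.

End StoneExt.

(** * Interpolation along a sparse sequence *)

Section Interpolation.
Local Open Scope ring_scope.
Context {R : realType}.

(* McShane's extension formula. *)
Lemma lipschitz_interpolation (T : Type) (f : T -> R) (x : nat -> T)
    (v : nat -> R) :
  (forall n, 0 <= v n) ->
  (forall n m, v n - v m <= `|f (x n) - f (x m)|) ->
  exists2 h : T -> R, (forall s t, `|h s - h t| <= `|f s - f t|) &
    forall n, h (x n) = v n.
Proof.
move=> v0 vL; pose S t := range (fun n => v n + `|f t - f (x n)|).
have S0 t : S t !=set0 by exists (v 0%N + `|f t - f (x 0%N)|), 0%N.
have Slb t : has_lbound (S t) by exists 0 => _ [n _ <-]; rewrite addr_ge0.
have hle s t : inf (S s) - inf (S t) <= `|f s - f t|.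
  rewrite lerBlDr -lerBlDl; apply: lb_le_inf => // _ [n _ <-].
  rewrite lerBlDl; apply: (@le_trans _ _ (v n + `|f s - f (x n)|)).
    by apply: ge_inf => //; exists n.
  have := ler_distD (f t) (f s) (f (x n)); lra.
exists (fun t => inf (S t)) => [s t|n].
  by rewrite ler_norml hle andbT lerNl opprB distrC hle.
apply/eqP; rewrite eq_le; apply/andP; split.
  by apply: ge_inf => //; exists n => //; rewrite subrr normr0 addr0.
by apply: lb_le_inf => // _ [m _ <-]; rewrite -lerBlDl.
Qed.

Lemma lipschitz_rel_continuous (T : topologicalType) (f h : T -> R) :
  continuous f -> (forall s t, `|h s - h t| <= `|f s - f t|) -> continuous h.
Proof.
move=> cf hf t; apply/cvgrPdist_lt => e e0.
have /cvgrPdist_lt/(_ _ e0) := cf t; apply: filterS => s.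
exact: le_lt_trans (hf _ _).
Qed.

Lemma unbounded_sparse_seq (T : Type) (f : T -> R) :
  (forall c, exists x, c < f x) ->
  exists2 x : nat -> T, (forall n, n%:R <= f (x n)) &
    forall n m, (n < m)%N -> m%:R <= f (x m) - f (x n).
Proof.
move=> /choice[G fG].
(* Here [n] is the successor of [n'], so the last step up to [x m] alone already raises [f] by more
   than [m]. *)
pose x := fix x n := if n is n'.+1 then G (f (x n') + n%:R) else G 0.
have xS n : f (x n) + n.+1%:R < f (x n.+1) by exact: fG.
have x0 n : 0 < f (x n).
  elim: n => [|n IH]; first exact: fG.
  by apply: lt_trans (xS n); rewrite ltr_wpDr.
have xD n m : (n < m)%N -> m%:R <= f (x m) - f (x n).
  elim: m => // m IH; rewrite ltnS leq_eqVlt => /predU1P[->|/IH].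
    by have := xS m; lra.
  have := xS m; have : 0 <= m%:R :> R by []; lra.
exists x => // -[|n]; first exact: ltW.
by have := xD 0%N n.+1 isT; have := x0 0%N; lra.
Qed.

End Interpolation.

(** * Points at which f^* is infinite, and the equivalence *)

Lemma infinite_limit_of_finite_points (R : realType) (X K : topologicalType)
    (i : X -> K) (f : X -> R) :
  is_stone_cech i -> Cont X f -> (forall c, exists x, (c < f x)%R) ->
  exists (h : X -> R) (q : nat -> K) (p : K),
    [/\ Cont X h, (forall k, stone_ext i f (q k) = None),
        (forall k, exists r, stone_ext i h (q k) = Some r),
        stone_ext i h p = None & closure (range q) p].
Proof.
move=> sci cf /unbounded_sparse_seq[x xn xD]; have [cF Ff] := stone_extP sci cf.
have cK := stone_cech_compact sci.
have log_le n : (logn 2 n <= n)%N by case: n => // n; exact/ltnW/ltn_logl.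
(* Two 2-adic valuations differ by at most the larger index, which in turn is at most the gap of
   [f]. *)
have [//|n m|h hL hx] := @lipschitz_interpolation R _ f x
    (fun n => (logn 2 n)%:R%R).
  have [nm|mn|->] := ltngtP n m; last by rewrite !subrr normr0.
    rewrite distrC; apply: le_trans (le_trans (xD n m nm) (ler_norm _)).
    rewrite lerBlDr -natrD ler_nat; apply: leq_trans (log_le n) _.
    exact: leq_trans (ltnW nm) (leq_addr _ _).
  apply: le_trans (le_trans (xD m n mn) (ler_norm _)).
  rewrite lerBlDr -natrD ler_nat; apply: leq_trans (log_le n) _.
  exact: leq_addr.
have ch := lipschitz_rel_continuous cf hL; have [cH Hh] := stone_extP sci ch.
have qP k : exists q, stone_ext i f q = None /\
    stone_ext i h q = Some (k%:R%R : R).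
  (* These are the positive integers of 2-adic valuation [k]: [h] equals [k] along [x (s n)], while
     [f (x (s n)) >= s n >= n]. *)
  pose s n := (2 ^ k * n.*2.+1)%N.
  have [q [_ clq]] := cK ((i \o x \o s) @ \oo) _ filterT.
  exists q; split.
    apply: (cluster_seq_infty (v := fun n => f (x (s n))) cF _ _ clq) => n.
      exact: Ff.
    apply: le_trans (xn _); rewrite ler_nat /s.
    apply: (@leq_trans n.*2.+1); first by rewrite -addnn -addnS leq_addr.
    by apply: leq_pmull; rewrite expn_gt0.
  apply: (@cluster_seq_closed _ _ (stone_ext i h @^-1` [set Some _]) _ _ _ clq).
    apply: preimage_closed => [? _|]; first exact: cH.
    exact: (accessible_closed_set1 (hausdorff_accessible hausdorff_opcR)).
  move=> n /=; rewrite Hh hx /s lognM ?expn_gt0// pfactorK//.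
  by rewrite logn_coprime ?addn0// coprime2n /= odd_double.
have [q qfh] := choice qP.
have [p [_ clp]] := cK (q @ \oo) _ filterT.
exists h, q, p; split=> // [k|k||]; first by have [] := qfh k.
- by have [_ ->] := qfh k; exists k%:R%R.
- apply: (cluster_seq_infty (v := fun n => n%:R%R) cH _ _ clp) => // n.
  by have [] := qfh n.
- by move=> A nA; apply: clp => //; exists 0%N => // n _; exists n.
Qed.

Theorem theorem2p3 (R : realType) (X betaX : topologicalType) (i : X -> betaX) :
  completely_regular_space X -> hausdorff_space X -> is_stone_cech i ->
  (forall Y : set betaX, range i `<=` Y -> realcompact (R := R) Y ->
     exists P : set (set X),
       ideal_of_closed_sets P /\ Y = upsilon (R := R) i P)
  <-> pseudocompact (R := R) X.
Proof.
move=> _ _ sci; split=> [aX|psX Y iY rcY]; last first.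
  (* For the empty family, [C_ P] is empty and [upsilon] is all of beta X. *)
  exists set0; split; first by split.
  rewrite (pseudocompact_realcompact_full sci psX iY rcY).
  by apply/seteqP; split=> // p _ f [].
move=> f0 cf0; apply: contrapT => unb.
(* The absolute value turns unboundedness into unboundedness above. *)
pose f x : R := `|f0 x|%R.
have cf : Cont X f by move=> x; apply: cvg_norm; exact: cf0.
have ub c : exists x, (c < f x)%R.
  apply: contrapT => nc; apply: unb; exists c; split; first exact: num_real.
  move=> d cd x _; apply: le_trans (ltW cd); rewrite leNgt; apply/negP => cx.
  by apply: nc; exists x.
have [h [q [p [ch fq hq hp clp]]]] := infinite_limit_of_finite_points sci cf ub.
have [||P [iP YE]] := aX [set y | exists r, stone_ext i h y = Some r].
- by move=> _ [x _ <-]; exists (h x); have [_ ->] := stone_extP sci ch.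
- exact: realcompact_finite_locus.
(* Relative closedness, applied to the set of all [q k], puts [p] in [upsilon], although h^* is
   infinite at [p]. *)
have : upsilon (R := R) i P p.
  apply: (upsilon_rel_closed sci iP cf _ _ clp); first by move=> _ [k _ <-].
  by rewrite -YE => _ [k _ <-]; exact: hq.
by rewrite -YE => -[r]; rewrite hp.
Qed.
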